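(* Let $m,n\ge1$ and $k\ge0$ be integers. For $\mathbf{x}\in(\mathbb{Z}_m)^n$ let $\mathcal{Z}(\mathbf{x})$ be the number of coordinates of $\mathbf{x}$ equal to $0$. Let $A=\mathbf{A}_{\mathrm{Bin}}((\mathbb{Z}_m)^n,\mathcal{Z},k)$ be the $m^n\times m^n$ matrix with rows and columns indexed by $(\mathbb{Z}_m)^n$ and $(\mathbf{f},\mathbf{g})$-entry $\binom{\mathcal{Z}(\mathbf{g}-\mathbf{f})}{k}$. Fix a primitive $m$-th root of unity $\zeta$ and, for $\mathbf{y}\in(\mathbb{Z}_m)^n$, let $\chi^{\mathbf{y}}(\mathbf{x})=\zeta^{\sum_i y_ix_i}$ be the associated irreducible character. For $\mathbf{y}\in(\mathbb{Z}_m)^n$ set $$\lambda_{\mathbf{y}}=m^{n-k}\binom{\mathcal{Z}(\mathbf{y})}{n-k}.$$ Then: (1) each $\lambda_{\mathbf{y}}$ is an eigenvalue of $A$; (2) the eigenvalues of $A$, counted with multiplicity, are exactly the values $\lambda_{\mathbf{y}}$, $\mathbf{y}\in(\mathbb{Z}_m)^n$, each $\mathbf{y}$ contributing multiplicity $1$; (3) each $\lambda_{\mathbf{y}}$ is an integer; (4) $0\le\lambda_{\mathbf{y}}\le m^{n-k}\binom{n}{k}$.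
   Context: Binomial coefficients $\binom{a}{b}$ are $0$ when $b>a$ or $b<0$ (so for $k>n$ all quantities $\lambda_{\mathbf{y}}$ are $0$). *)

(* Defs.v *)
From HB Require Import structures.
From mathcomp Require Import all_boot all_order all_algebra.

Set Implicit Arguments.
Unset Strict Implicit.
Unset Printing Implicit Defensive.

Import GRing.Theory Num.Theory.
Local Open Scope ring_scope.

(* The group Z/m for every m >= 1, the trivial group m = 1 included: 'Z_m is
   unusable here since 'Z_1 is Z/2.  For m = 0 this is the junk value 'I_1. *)
Notation Zmod m := 'I_m.-1.+1.

Definition zeros (m n : nat) (x : 'rV[Zmod m]_n) : nat :=
  #|[set i : 'I_n | x 0 i == 0]|.

(* Rows and columns are indexed by G through its enumeration. *)
Definition ABin (C : pzSemiRingType) (G : finZmodType) (F : G -> nat) (k : nat) :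
    'M[C]_#|G| :=
  \matrix_(f, g) ('C(F (enum_val g - enum_val f), k))%:R.

(* Binomial coefficient with an integer lower index, 0 if that index is
   negative. *)
Definition binz (a : nat) (b : int) : nat :=
  if b is Posz j then 'C(a, j) else 0%N.

(* The exponent and the lower index are the integer n - k, not the truncated
   difference. *)
Definition lambda (C : unitRingType) (m n k : nat) (y : 'rV[Zmod m]_n) : C :=
  m%:R ^ (n%:Z - k%:Z) * (binz (zeros y) (n%:Z - k%:Z))%:R.

(* Main.v *)
Require Import Defs.
From HB Require Import structures.
From mathcomp Require Import all_boot all_order all_algebra.

Set Implicit Arguments.
Unset Strict Implicit.
Unset Printing Implicit Defensive.

Import GRing.Theory Num.Theory.
Local Open Scope ring_scope.

(** The matrix is a convolution operator on the group, so the characters are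
    eigenvectors and the eigenvalue at [y] is the Fourier coefficient
    [\sum_h 'C(Z h, k) * chi y h].  Since ['C(Z h, k)] counts the [k]-subsets [S]
    of the zero set of [h], this is the sum over [S] of the products over [i] of
    [\sum_(a | i \in S ==> a = 0) zeta ^ (y_i a)].  The factor at [i] is [1] on [S]
    and [m * [y_i = 0]] off [S], so only those [S] count whose complement, an
    [(n - k)]-set, lies in the zero set of [y]. *)

(** Over polynomials the relation becomes [('X - A) P = P ('X - D)]; taking determinants, the
    nonzero constant [\det P] cancels. *)
Lemma char_poly_intertwine (F : fieldType) (N : nat) (A D P : 'M[F]_N) :
  P \in unitmx -> A *m P = P *m D -> char_poly A = char_poly D.
Proof.
move=> uP AP; set Q := map_mx polyC P.
have dQ : \det Q != 0.
  by rewrite det_map_mx polyC_eq0 -unitfE -unitmxE.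
apply: (mulIf dQ).
rewrite [RHS]mulrC /char_poly -!det_mulmx /char_poly_mx mulmxBl mulmxBr.
by rewrite -!map_mxM AP scalar_mxC.
Qed.

Lemma char_poly_diag (R : comNzRingType) (N : nat) (d : 'rV[R]_N) :
  char_poly (diag_mx d) = \prod_(i < N) ('X - (d 0 i)%:P).
Proof.
rewrite char_poly_trig ?diag_mx_is_trig //.
by apply: eq_bigr => i _; rewrite mxE eqxx mulr1n.
Qed.

Lemma prodr_bool (R : comPzSemiRingType) (I : finType) (b : pred I) :
  \prod_i (b i)%:R = [forall i, b i]%:R :> R.
Proof.
have [/forallP allb|] := boolP [forall i, b i].
  by apply: big1 => i _; rewrite allb.
by rewrite negb_forall => /existsP[i /negPf bi]; rewrite (bigD1 i) //= bi mul0r.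
Qed.

Lemma sum_row_prod (R : comPzSemiRingType) (T : finType) (n : nat)
    (G : 'I_n -> T -> R) :
  \sum_(h : 'rV[T]_n) \prod_i G i (h 0 i) = \prod_i \sum_a G i a.
Proof.
rewrite bigA_distr_bigA.
rewrite (reindex (fun f : {ffun 'I_n -> T} => \row_i f i)) /=.
  by apply: eq_bigr => f _; apply: eq_bigr => i _; rewrite mxE.
exists (fun h : 'rV[T]_n => [ffun i => h 0 i]) => [f|h] _.
  by apply/ffunP => i; rewrite ffunE mxE.
by apply/rowP => i; rewrite mxE ffunE.
Qed.

Lemma binomial_zeros (R : comPzSemiRingType) (m n k : nat) (x : 'rV[Zmod m]_n) :
  'C(zeros x, k)%:R
  = \sum_(S : {set 'I_n} | #|S| == k) \prod_i ((i \in S) ==> (x 0 i == 0))%:R :> R.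
Proof.
rewrite /zeros -cards_draws -sum1_card natr_sum.
under [RHS]eq_bigr => S _ do rewrite prodr_bool.
rewrite big_mkcond [RHS]big_mkcond; apply: eq_bigr => S _ /=.
rewrite inE andbC; case: (_ == k) => //=.
have -> : [forall i, (i \in S) ==> (x 0 i == 0)]
  = (S \subset [set i : 'I_n | x 0 i == 0]).
  apply/forallP/subsetP => H i; first by move=> iS; rewrite inE; apply: implyP iS.
  by apply/implyP => /H; rewrite inE.
by case: (_ \subset _).
Qed.

Section Characters.

Variables (F : fieldType) (p : nat) (zeta : F).
Hypothesis zeta_prim : p.+1.-primitive_root zeta.

(** A product of powers rather than a power of a sum, so that [sum_row_prod] applies coordinate by
    coordinate. *)
Definition chi (n : nat) (y x : 'rV['I_p.+1]_n) : F :=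
  \prod_i zeta ^+ (y 0 i * x 0 i).

Lemma chiC (n : nat) (y x : 'rV['I_p.+1]_n) : chi y x = chi x y.
Proof. by apply: eq_bigr => i _; rewrite mulnC. Qed.

Lemma chiD (n : nat) (y x x' : 'rV['I_p.+1]_n) :
  chi y (x + x') = chi y x * chi y x'.
Proof.
rewrite -big_split; apply: eq_bigr => i _ /=; rewrite mxE /= -exprD -mulnDr.
by rewrite -(prim_expr_mod zeta_prim) modnMmr (prim_expr_mod zeta_prim).
Qed.

Lemma sum_root_powers (a : 'I_p.+1) :
  \sum_(b : 'I_p.+1) zeta ^+ (a * b) = p.+1%:R * (a == 0)%:R.
Proof.
have [->|a0] := eqVneq a 0.
  under eq_bigr => b _ do rewrite mul0n expr0.
  by rewrite sumr_const card_ord mulr1.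
rewrite mulr0; apply/eqP.
(* Multiplying the geometric sum by this nonzero factor gives [zeta ^+ (a * p.+1) - 1], which is
   0. *)
have za : zeta ^+ a - 1 != 0.
  rewrite subr_eq0 -(prim_order_dvd zeta_prim).
  by apply: contra a0 => /dvdnP[[|q] aE]; apply/eqP/val_inj => //=;
     have := ltn_ord a; rewrite aE mulSn ltnNge leq_addr.
rewrite -(mulrI_eq0 _ (mulfI za)); under eq_bigr => b _ do rewrite exprM.
by rewrite -subrX1 -exprM mulnC exprM (prim_expr_order zeta_prim) expr1n subrr.
Qed.

(** Orthogonality of characters, which makes the character matrix invertible. By the symmetry of
    [chi] the sum factors over the coordinates. *)
Lemma sum_chi (n : nat) (x : 'rV['I_p.+1]_n) :
  \sum_y chi y x = p.+1%:R ^+ n * (x == 0)%:R.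
Proof.
under eq_bigr => y _ do rewrite chiC.
rewrite /chi (sum_row_prod (fun i (b : 'I_p.+1) => zeta ^+ (x 0 i * b))).
under eq_bigr => i _ do rewrite sum_root_powers.
rewrite big_split prodr_const card_ord prodr_bool; congr (_ * _%:R).
congr (nat_of_bool _); apply/forallP/eqP => [H|-> i]; last by rewrite mxE.
by apply/rowP => i; rewrite mxE; apply/eqP.
Qed.

Lemma fourier_binomial_zeros (n k : nat) (y : 'rV['I_p.+1]_n) :
  \sum_h 'C(@zeros p.+1 n h, k)%:R * chi y h = @lambda F p.+1 n k y.
Proof.
rewrite /lambda; have [kn|nk] := leqP k n; last first.
  (* Exposing [n - k] as a [Negz] makes [binz] compute to 0. *)
  rewrite -opprB (subzn (ltnW nk)) -(subnSK nk) /= mulr0.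
  apply: big1 => h _; rewrite bin_small ?mul0r //.
  by apply: leq_ltn_trans nk; rewrite -[n in (_ <= n)%N]card_ord max_card.
rewrite subzn //= binomial_zeros mulr_sumr.
under eq_bigr => h _ do rewrite binomial_zeros mulr_suml.
(* Passing to the complement [T] of [S] turns the left sum into one over [(n - k)]-sets, to be
   matched term by term with the expansion of ['C(zeros y, n - k)]. *)
rewrite exchange_big (reindex_inj (@setC_inj _)) /=.
apply: eq_big => [T|T].
  have := cardsC T; rewrite card_ord => cT.
  by rewrite -(eqn_add2l #|T|) cT -{1}(subnK kn) eqn_add2r eq_sym.
rewrite -(eqn_add2l #|T|) cardsC card_ord -{1}(subnK kn) eqn_add2r => /eqP TE.
under eq_bigr => h _ do rewrite -big_split /=.
rewrite (sum_row_prod (fun i (a : 'I_p.+1) =>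
  ((i \in ~: T) ==> (a == 0))%:R * zeta ^+ (y 0 i * a))).
(* As [#|T|] is [n - k], the power of [p.+1] splits into one factor for each coordinate in [T]. *)
rewrite -exprnP TE -prodr_const [X in _ = X * _]big_mkcond -big_split; apply: eq_bigr => i _ /=.
rewrite inE; case: (i \in T) => /=.
  by rewrite -sum_root_powers; apply: eq_bigr => a _; rewrite mul1r.
rewrite mulr1 (bigD1 0) //= muln0 mulr1 big1 ?addr0 // => a /negPf ->.
by rewrite mul0r.
Qed.

End Characters.

Theorem theorem4p5 (C : numClosedFieldType) (m n k : nat)
    (hm : (1 <= m)%N) (hn : (1 <= n)%N)
    (zeta : C) (hzeta : m.-primitive_root zeta) :
  let A : 'M[C]_#|'rV[Zmod m]_n| := ABin C (@zeros m n) k in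
  [/\ forall y : 'rV[Zmod m]_n, eigenvalue A (lambda C k y),
      char_poly A = \prod_(y : 'rV[Zmod m]_n) ('X - (lambda C k y)%:P),
      forall y : 'rV[Zmod m]_n, exists z : int, lambda C k y = z%:~R
    & forall y : 'rV[Zmod m]_n,
        0 <= lambda C k y <= m%:R ^ (n%:Z - k%:Z) * ('C(n, k))%:R].
Proof.
case: m hm hzeta => // p _ zeta_prim A.
have cpA : char_poly A = \prod_(y : 'rV[Zmod p.+1]_n) ('X - (lambda C k y)%:P).
  (* The columns of [X] are the characters; [Y] is its inverse up to the scalar [p.+1 ^ n]. *)
  pose X : 'M[C]_#|'rV['I_p.+1]_n| :=
    \matrix_(f, y) chi zeta (enum_val y) (enum_val f).
  pose Y : 'M[C]_#|'rV['I_p.+1]_n| :=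
    \matrix_(y, f) chi zeta (enum_val y) (- enum_val f).
  pose d : 'rV[C]_#|'rV['I_p.+1]_n| := \row_(y < _) @lambda C p.+1 n k (enum_val y).
  have XY : X *m Y = (p.+1%:R ^+ n)%:M.
    apply/matrixP => f g; rewrite !mxE.
    under eq_bigr => y _ do rewrite !mxE -(chiD zeta_prim).
    rewrite -(big_enum_val (A := predT) (fun y => chi zeta y (enum_val f - enum_val g))) /=.
    rewrite (sum_chi zeta_prim) subr_eq0 (inj_eq enum_val_inj).
    by case: (f == g); rewrite ?mulr1 ?mulr0.
  have uX : X \in unitmx.
    have p0 : p.+1%:R ^+ n != 0 :> C by rewrite expf_neq0 // pnatr_eq0.
    suff /mulmx1_unit[] : X *m ((p.+1%:R ^+ n)^-1 *: Y) = 1%:M by [].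
    by rewrite -scalemxAr XY scale_scalar_mx mulVf.
  have AX : A *m X = X *m diag_mx d.
    apply/matrixP => f y; rewrite mul_mx_diag !mxE.
    under eq_bigr => g _ do rewrite !mxE.
    rewrite -(big_enum_val (A := predT) (fun g =>
      'C(@zeros p.+1 n (g - enum_val f), k)%:R * chi zeta (enum_val y) g)) /=.
    rewrite -(fourier_binomial_zeros zeta_prim) mulr_sumr.
    (* Substituting [g = h + f] lets [chi y f] factor out of the convolution. *)
    rewrite (reindex_inj (addIr (enum_val f))); apply: eq_bigr => h _ /=.
    by rewrite addrK (chiD zeta_prim) [RHS]mulrC -mulrA.
  rewrite (char_poly_intertwine uX AX) char_poly_diag.
  under eq_bigr => i _ do rewrite mxE.
  by rewrite -(big_enum_val (A := predT) (fun y => 'X - (@lambda C p.+1 n k y)%:P)).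
have zn (y : 'rV[Zmod p.+1]_n) : (zeros y <= n)%N.
  by rewrite -[n in (_ <= n)%N]card_ord max_card.
split=> [y|//|y|y].
- by rewrite eigenvalue_root_char cpA (bigD1 y) //= rootM root_XsubC eqxx.
(* A negative power of [p.+1] does no harm: [binz] vanishes there. *)
- rewrite /lambda; case: (n%:Z - k%:Z) => j /=; last by exists 0; rewrite mulr0.
  by exists (p.+1 ^ j * 'C(zeros y, j))%N%:Z; rewrite -exprnP -natrX -natrM pmulrn.
rewrite /lambda mulr_ge0 ?exprz_ge0 ?ler0n //= ler_wpM2l ?exprz_ge0 ?ler0n //.
rewrite ler_nat; have [kn|nk] := leqP k n; last first.
  by rewrite -opprB (subzn (ltnW nk)) -(subnSK nk).
by rewrite subzn //= -(bin_sub kn) leq_bin2l.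
Qed.
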